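(* Consider the sparse linear Gaussian model: $S\in\{1,\dots,N\}$, $\mathcal{X}_S=\{\mathbf{x}\in\mathbb{R}^N:\|\mathbf{x}\|_0\le S\}$, $\mathbf{H}\in\mathbb{R}^{M\times N}$ with $\operatorname{spark}(\mathbf{H})>S$, $\sigma>0$, observation $\mathbf{y}=\mathbf{H}\mathbf{x}+\mathbf{n}$, $\mathbf{n}\sim\mathcal{N}(\mathbf{0},\sigma^2\mathbf{I})$, and parameter function $g(\mathbf{x})=x_k$ for a fixed $k\in[N]$. Let $D=\operatorname{rank}(\mathbf{H})$, $\mathbf{H}=\mathbf{U}\mathbf{\Sigma}\mathbf{V}^T$ a thin SVD and $\widetilde{\mathbf{H}}=\mathbf{V}\mathbf{\Sigma}^{-1}$. Let $\mathbf{x}_1\in\mathbb{R}^D$, $C\ge 0$, and let $(a[\mathbf{p}])_{\mathbf{p}\in\mathbb{Z}_+^D}$ satisfy $|a[\mathbf{p}]|\le C^{|\mathbf{p}|}$ for all $\mathbf{p}$. Then the function $$c(\mathbf{x})=\exp\big(\mathbf{x}_1^T\widetilde{\mathbf{H}}^{\dagger}\mathbf{x}\big)\sum_{\mathbf{p}\in\mathbb{Z}_+^D}\frac{a[\mathbf{p}]}{\mathbf{p}!}\Big(\tfrac{1}{\sigma}\widetilde{\mathbf{H}}^{\dagger}\mathbf{x}\Big)^{\mathbf{p}}-x_k,\qquad \mathbf{x}\in\mathcal{X}_S,$$ is a valid bias function at every $\mathbf{x}_0\in\mathcal{X}_S$. In particular, for $\mathbf{H}=\mathbf{I}$ (with thin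 SVD $\mathbf{U}=\mathbf{V}=\mathbf{\Sigma}=\mathbf{I}$), the choice $\mathbf{x}_1=\mathbf{0}$, $a[\mathbf{e}_k]=\sigma$ and $a[\mathbf{p}]=0$ for all other $\mathbf{p}$ yields $c\equiv 0$.
   Context: $[N]=\{1,\dots,N\}$; $\|\mathbf{x}\|_0$ = number of nonzero entries; $\operatorname{spark}$ = minimum number of linearly dependent columns; $\dagger$ = Moore–Penrose pseudoinverse. Thin SVD: $\mathbf{U}\in\mathbb{R}^{M\times D}$, $\mathbf{V}\in\mathbb{R}^{N\times D}$ with orthonormal columns, $\mathbf{\Sigma}$ diagonal positive. Multi-index notation: $|\mathbf{p}|=\sum p_l$, $\mathbf{p}!=\prod p_l!$, $\mathbf{z}^{\mathbf{p}}=\prod z_l^{p_l}$; $\mathbf{e}_k$ is the $k$th unit multi-index. An estimator $\hat g:\mathbb{R}^M\to\mathbb{R}$ has bias $b(\hat g;\mathbf{x})=\mathsf{E}_{\mathbf{x}}\{\hat g(\mathbf{y})\}-x_k$ and variance $v(\hat g;\mathbf{x})$; a bias function $c:\mathcal{X}_S\to\mathbb{R}$ is valid at $\mathbf{x}_0$ if some estimator has $v(\hat g;\mathbf{x}_0)<\infty$ and $b(\hat g;\mathbf{x})=c(\mathbf{x})$ for all $\mathbf{x}\in\mathcal{X}_S$. *)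

(* Defs.v *)
From HB Require Import structures.
From mathcomp Require Import all_boot all_order all_algebra.
From mathcomp Require Import all_classical all_reals all_analysis.
Set Implicit Arguments. Unset Strict Implicit. Unset Printing Implicit Defensive.
Import Order.TTheory GRing.Theory Num.Theory.
Local Open Scope ring_scope.

Section Defs.
Variable R : realType.

Definition l0 (N : nat) (x : 'cV[R]_N) : nat := #|[set i | x i 0 != 0]|.
Definition sparse_set (N S : nat) : set 'cV[R]_N := [set x | (l0 x <= S)%N].

Definition cols_dependent (M N : nat) (H : 'M[R]_(M, N)) (T : {set 'I_N}) : Prop :=
  exists x : 'cV[R]_N, x != 0 /\ (forall i, i \notin T -> x i 0 = 0) /\ H *m x = 0.
(** spark(H) > S : the minimum number of linearly dependent columns exceeds S
    (vacuous if no set of columns is dependent, i.e. spark = +oo) *)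
Definition spark_gt (M N : nat) (H : 'M[R]_(M, N)) (S : nat) : Prop :=
  forall T : {set 'I_N}, cols_dependent H T -> (S < #|T|)%N.

Definition thin_svd (M N D : nat) (H : 'M[R]_(M, N)) (U : 'M[R]_(M, D))
  (Sig : 'M[R]_D) (V : 'M[R]_(N, D)) : Prop :=
  [/\ U^T *m U = 1%:M, V^T *m V = 1%:M, is_diag_mx Sig,
      (forall i, 0 < Sig i i) & H = U *m Sig *m V^T].

Definition is_MP_pinv (m n : nat) (A : 'M[R]_(m, n)) (B : 'M[R]_(n, m)) : Prop :=
  [/\ A *m B *m A = A, B *m A *m B = B, (A *m B)^T = A *m B & (B *m A)^T = B *m A].

Definition mindex (D : nat) := {ffun 'I_D -> nat}.
Definition mabs (D : nat) (p : mindex D) : nat := (\sum_(l < D) p l)%N.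
Definition mfact (D : nat) (p : mindex D) : nat := (\prod_(l < D) (p l)`!)%N.
Definition mpow (D : nat) (z : 'cV[R]_D) (p : mindex D) : R := \prod_(l < D) z l 0 ^+ p l.
Definition unit_mindex (D : nat) (k : 'I_D) : mindex D := [ffun l => nat_of_bool (l == k)].

Definition msum (D : nat) (f : mindex D -> R) : R :=
  fine (\esum_(p in [set: mindex D]) (Num.max (f p) 0)%:E
      - \esum_(p in [set: mindex D]) (Num.max (- f p) 0)%:E)%E.

(** the candidate bias function c(x), with Hp = Htilde^dagger *)
Definition bias_c (N D : nat) (sigma : R) (k : 'I_N) (Hp : 'M[R]_(D, N))
  (x1 : 'cV[R]_D) (a : mindex D -> R) (x : 'cV[R]_N) : R :=
  expR ((x1^T *m Hp *m x) 0 0) *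
  msum (fun p => a p / (mfact p)%:R * mpow (sigma^-1 *: (Hp *m x)) p) - x k 0.

(** Gaussian expectation: iterated integral over independent coordinates
    y_i ~ N(m_i, s^2) *)
Fixpoint gauss_iter (s : R) (n : nat) : n.-tuple R -> (n.-tuple R -> \bar R) -> \bar R :=
  match n with
  | 0 => fun _ f => f [tuple]
  | n'.+1 => fun m f =>
      (\int[normal_prob (thead m) s]_t
         gauss_iter s (behead_tuple m) (fun u => f [tuple of t :: u]))%E
  end.

Definition tup2col (n : nat) (t : n.-tuple R) : 'cV[R]_n := \col_i tnth t i.
Definition col2tup (n : nat) (v : 'cV[R]_n) : n.-tuple R := [tuple v i 0 | i < n].

(** E_x { f(y) } with y = H x + n, n ~ N(0, sigma^2 I) *)
Definition Egauss (M N : nat) (H : 'M[R]_(M, N)) (sigma : R) (x : 'cV[R]_N)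
  (f : 'cV[R]_M -> \bar R) : \bar R :=
  gauss_iter sigma (col2tup (H *m x)) (fun t => f (tup2col t)).

Definition est_mean M N (H : 'M[R]_(M, N)) sigma x (g : 'cV[R]_M -> R) : R :=
  fine (Egauss H sigma x (fun y => (g y)%:E)).
Definition est_var M N (H : 'M[R]_(M, N)) sigma x (g : 'cV[R]_M -> R) : \bar R :=
  Egauss H sigma x (fun y => ((g y - est_mean H sigma x g) ^+ 2)%:E).
Definition est_bias M N (H : 'M[R]_(M, N)) sigma (k : 'I_N) x (g : 'cV[R]_M -> R) : R :=
  est_mean H sigma x g - x k 0.

Definition valid_bias (M N : nat) (H : 'M[R]_(M, N)) (sigma : R) (S : nat) (k : 'I_N)
  (c : 'cV[R]_N -> R) (x0 : 'cV[R]_N) : Prop :=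
  exists g : 'cV[R]_M -> R,
    [/\ measurable_fun [set: M.-tuple R] (fun t => g (tup2col t)),
        (forall x, sparse_set S x -> Egauss H sigma x (fun y => (`|g y|)%:E) < +oo)%E,
        (est_var H sigma x0 g < +oo)%E &
        (forall x, sparse_set S x -> est_bias H sigma k x g = c x)].

End Defs.

(* Main.v *)
(** Let [u = U^T y], which is Gaussian with mean [mu = Htilde^+ x] and covariance
    [sigma^2 I] since [H x = U mu] and [U^T U = 1].  Hence, with [e = - sigma^2],
    [E (prod_l exp (s_l u_l + e s_l^2 / 2)) = prod_l exp (s_l mu_l)].  Both sides are
    instances of [prod_l exp (s_l z_l + e s_l^2 / 2)], with [z = mu] and [e = 0] on
    the right.  Differentiating [p_l] times in each [s_l] multiplies the factors by
    [He_{p_l} (z_l + e s_l)], where [He_{n+1} = X He_n + e He_n'], and [He_n = X^n]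
    for [e = 0].  At [s = x_1], the estimator
    [sum_p a_p / (p! sigma^|p|)
             prod_l exp (s_l u_l + e s_l^2 / 2) He_{p_l} (u_l + e s_l)]
    therefore has the required mean, provided sum and expectation commute.  Replacing
    [e], [s] and [u] by their absolute values dominates every term by a derivative of
    the absolutely monotone function [s |-> exp (s |u| + |e| s^2 / 2)]; Taylor's
    formula then bounds the series by [prod_l exp (K |u_l| + |e| K^2 / 2)] with
    [K = |s_l| + C / sigma], which is integrable. *)

Require Import Defs.
From HB Require Import structures.
From mathcomp Require Import all_boot all_order all_algebra.
From mathcomp Require Import all_classical all_reals all_analysis.
From mathcomp Require Import measurable_realfun ring lra.
Set Implicit Arguments. Unset Strict Implicit. Unset Printing Implicit Defensive.
Import Order.TTheory GRing.Theory Num.Theory.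
Import numFieldNormedType.Exports.
Local Open Scope classical_set_scope.
Local Open Scope ring_scope.

Section product_measurability.
Context {R : realType} d1 d2 (T1 : measurableType d1) (T2 : measurableType d2).

Lemma measurable_fun_integral (m2 : {sigma_finite_measure set T2 -> \bar R})
    (f : T1 * T2 -> \bar R) :
  measurable_fun setT f ->
  measurable_fun setT (fun x => \int[m2]_y f (x, y))%E.
Proof.
move=> mf; rewrite (_ : (fun x => _) = fubini_F m2 f^\+ \- fubini_F m2 f^\-)%E.
  apply: emeasurable_funB; apply: measurable_fun_fubini_tonelli_F => //.
    exact: measurable_funepos.
  exact: measurable_funeneg.
apply/funext => x; rewrite integralE.
by congr (_ - _)%E; apply: eq_integral => y _; rewrite ?funeposE ?funenegE.
Qed.

Lemma measurable_fun_uncurry (F : nat -> T1 -> T2) :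
  (forall n, measurable_fun setT (F n)) ->
  measurable_fun setT (fun z : T1 * nat => F z.2 z.1).
Proof.
move=> mF _ A mA; rewrite setTI.
rewrite (_ : _ @^-1` A = \bigcup_n ((F n @^-1` A) `*` [set n])).
  apply: bigcup_measurable => n _; apply: measurableX => //.
  by rewrite -[X in measurable X]setTI; exact: mF.
apply/seteqP; split=> [[x n] /= Fx|[x n] [k _ [/= Fx ->]]//].
by exists n.
Qed.

End product_measurability.

(* The library only makes [counting] a sigma-finite content. *)
HB.instance Definition _ (R : realType) :=
  @Measure_isSigmaFinite.Build _ nat R (@counting nat R) (sigma_finite_counting R).

Section countable_sum.
Context {R : realType} {T : countType}.
Implicit Types (f : T -> R).

(* [Defs.msum] unfolds to [csum] on multi-indices; unqualified, [msum] would
   denote the library's finite sum of measures. *)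
Definition csum f : R :=
  fine (\esum_(p in [set: T]) (Num.max (f p) 0)%:E
      - \esum_(p in [set: T]) (Num.max (- f p) 0)%:E)%E.

Definition pickled f (n : nat) : R := oapp f 0 (pickle_inv n).

Lemma pickled_comp (g : R -> R) f : g 0 = 0 -> pickled (g \o f) = g \o pickled f.
Proof. by move=> g0; apply/funext => n; rewrite /pickled /=; case: pickle_inv. Qed.

Lemma esum_pickled f : (forall p, 0 <= f p) ->
  (\esum_(p in [set: T]) (f p)%:E = \int[counting]_n (pickled f n)%:E)%E.
Proof.
move=> f0; have pickled_ge0 n : (0 <= (pickled f n)%:E)%E.
  by rewrite lee_fin /pickled; case: pickle_inv.
rewrite ge0_integral_count// nneseries_esumT//.
transitivity (\esum_(p in [set: T]) (pickled f (pickle p))%:E)%E.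
  by apply: eq_esum => p _; rewrite /pickled pickleK_inv.
rewrite -(esum_image setT pickle (EFin \o pickled f)); last first.
  by move=> p q _ _ /(pcan_inj pickleK_inv).
rewrite esum_mkcond; apply: eq_esum => n _; case: ifPn => // /negP nP.
rewrite /pickled; case E: pickle_inv => [p|//]; exfalso; apply: nP.
by rewrite inE; exists p => //; have := @pickle_invK T n; rewrite E.
Qed.

Lemma csumE f : csum f = \int[counting]_n pickled f n.
Proof.
rewrite /csum /Rintegral integralE !esum_pickled; last 2 first.
- by move=> p; rewrite le_max lexx orbT.
- by move=> p; rewrite le_max lexx orbT.
congr (fine (_ - _)%E); apply: eq_integral => n _.
  rewrite (pickled_comp (g := fun x => Num.max x 0)) ?maxxx//.
  by rewrite funeposE EFin_max.
rewrite (pickled_comp (g := fun x => Num.max (- x) 0)) ?oppr0 ?maxxx//.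
by rewrite funenegE EFin_max.
Qed.

Lemma integrable_pickled f : summable [set: T] (EFin \o f) ->
  counting.-integrable setT (EFin \o pickled f).
Proof.
move=> sf; apply/integrableP; split => //; move: sf; rewrite /summable.
by rewrite (esum_pickled (f := fun p => `|f p|))// (pickled_comp _ (normr0 _)).
Qed.

Lemma csumZl c f : summable [set: T] (EFin \o f) ->
  csum (fun p => c * f p) = c * csum f.
Proof.
move=> /integrable_pickled intf; rewrite !csumE -RintegralZl//.
apply: eq_Rintegral => n _; rewrite /pickled; case: pickle_inv => //=.
by rewrite mulr0.
Qed.

Lemma normr_csum_le f (B : R) :
  (\esum_(p in [set: T]) `|f p|%:E <= B%:E)%E -> `|csum f| <= B.
Proof.
move=> fB; have intf : counting.-integrable setT (EFin \o pickled f).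
  by apply: integrable_pickled; exact: le_lt_trans (ltry B).
rewrite csumE; apply: le_trans (le_normr_Rintegral measurableT intf) _.
move: fB; rewrite esum_pickled// (pickled_comp _ (normr0 _)) => fB.
rewrite -lee_fin fineK// ge0_fin_numE ?(le_lt_trans fB) ?ltry//.
exact: integral_ge0.
Qed.

Lemma csum_set1 f p : (forall q, q != p -> f q = 0) -> csum f = f p.
Proof.
move=> f0; have esum_comp (g : R -> R) : g 0 = 0 -> (forall x, 0 <= g x) ->
    (\esum_(q in [set: T]) (g (f q))%:E = (g (f p))%:E)%E.
  move=> g0 g_ge0.
  rewrite -[RHS](esum_set1 (t := p) (a := fun q => (g (f q))%:E)) ?lee_fin//.
  rewrite [RHS]esum_mkcond; apply: eq_esum => q _; case: ifPn => // qp.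
  by rewrite f0 ?g0//; apply: contra qp => /eqP ->; exact/mem_set.
have max0_ge0 x : 0 <= Num.max x 0 :> R by rewrite le_max lexx orbT.
rewrite /csum (esum_comp (Num.max^~ 0)) ?maxxx//.
rewrite (esum_comp (fun x => Num.max (- x) 0)) ?oppr0 ?maxxx// -EFinB /=.
by rewrite -[RHS](congr1 (@^~ p) (funrposBneg f)).
Qed.

End countable_sum.

Section integral_countable_sum.
Context {R : realType} {T : countType} d (Y : measurableType d).
Variables (P : {sigma_finite_measure set Y -> \bar R}) (f : T -> Y -> R) (B : Y -> R).
Hypothesis mf : forall p, measurable_fun setT (f p).

Let F (z : Y * nat) : \bar R := (pickled (f^~ z.1) z.2)%:E.

Let mF : measurable_fun setT F.
Proof.
apply/measurable_EFinP.
apply: (measurable_fun_uncurry (F := fun n y => pickled (f^~ y) n)) => n.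
by rewrite /pickled; case: pickle_inv.
Qed.

Lemma measurable_csum : measurable_fun setT (fun y => csum (f^~ y)).
Proof.
under eq_fun do rewrite csumE.
apply: (measurableT_comp (f := @fine R)); first exact: fine_measurable.
exact: (measurable_fun_integral counting mF).
Qed.

Hypothesis fB : forall y, (\esum_(p in [set: T]) `|f p y|%:E <= (B y)%:E)%E.
Hypothesis intB : P.-integrable setT (EFin \o B).

Let summable_f y : summable [set: T] (EFin \o f^~ y).
Proof. exact: le_lt_trans (fB y) (ltry _). Qed.

Let integrable_f p : P.-integrable setT (EFin \o f p).
Proof.
apply: (le_integrable _ _ _ intB) => //; first exact/measurable_EFinP.
move=> y _; apply: le_trans (lee_abs _); apply: le_trans (fB y).
by apply: esum_ge; exists [set p]; rewrite ?fsbig_set1.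
Qed.

Let integrable_F : (P \x counting)%E.-integrable setT F.
Proof.
apply/integrable12ltyP => //; have /integrableP[_] := intB; apply: le_lt_trans.
apply: ge0_le_integral => //.
- by move=> y _; exact: integral_ge0.
- apply: (measurable_fun_integral counting (f := abse \o F)).
  exact: measurableT_comp.
- by apply: measurableT_comp => //; exact: measurable_int intB.
move=> y _; apply: le_trans (lee_abs _).
apply: le_trans (fB y); rewrite esum_pickled// (pickled_comp _ (normr0 _)).
exact: lexx.
Qed.

Lemma Rintegral_csum :
  \int[P]_y csum (f^~ y) = csum (fun p => \int[P]_y f p y).
Proof.
transitivity (fine (\int[P]_y \int[counting]_n F (y, n))%E).
  congr fine; apply: eq_integral => y _; rewrite csumE fineK//.
  exact/integrable_fin_num/integrable_pickled/summable_f.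
rewrite (Fubini integrable_F) csumE; congr fine; apply: eq_integral => n _.
rewrite /F /pickled; case: pickle_inv => [p|] /=; last exact: integral0.
by rewrite fineK// (integrable_fin_num measurableT (integrable_f p)).
Qed.

End integral_countable_sum.

Section exp_bounded.
Context {R : realType} {Y : Type}.
Implicit Types (f g h k : Y -> R) (c : R).

Definition exp_bounded h f := exists A K : R,
  [/\ 0 <= A, 0 <= K & forall y, `|f y| <= A * expR (K * h y)].

Lemma exp_bounded_cst h c : exp_bounded h (cst c).
Proof. by exists `|c|, 0; split => // y; rewrite mul0r expR0 mulr1. Qed.

Lemma exp_boundedM h f g :
  exp_bounded h f -> exp_bounded h g -> exp_bounded h (f \* g).
Proof.
move=> [A [K [A0 K0 fA]]] [B [L [B0 L0 gB]]].
exists (A * B), (K + L); split; [exact: mulr_ge0|exact: addr_ge0|move=> y].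
by rewrite normrM mulrDl expRD mulrACA ler_pM.
Qed.

Lemma exp_boundedB h f g : (forall y, 0 <= h y) ->
  exp_bounded h f -> exp_bounded h g -> exp_bounded h (f \- g).
Proof.
move=> h0 [A [K [A0 K0 fA]]] [B [L [B0 L0 gB]]].
exists (A + B), (K + L); split; [exact: addr_ge0|exact: addr_ge0|move=> y].
rewrite (le_trans (ler_normB _ _))// [leRHS]mulrDl lerD//.
  by rewrite (le_trans (fA y))// ler_wpM2l// ler_expR ler_wpM2r// lerDl.
by rewrite (le_trans (gB y))// ler_wpM2l// ler_expR ler_wpM2r// lerDr.
Qed.

Lemma exp_bounded_norm h f : exp_bounded h f -> exp_bounded h (fun y => `|f y|).
Proof.
by move=> [A [K [A0 K0 fA]]]; exists A, K; split => // y; rewrite normr_id.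
Qed.

Lemma exp_bounded_prod h (I : Type) (r : seq I) (P : pred I) (f : I -> Y -> R) :
  (forall i, exp_bounded h (f i)) ->
  exp_bounded h (fun y => \prod_(i <- r | P i) f i y).
Proof.
move=> hf; elim: r => [|i r IH].
  by under eq_fun do rewrite big_nil; exact: exp_bounded_cst.
case Pi: (P i); under eq_fun do rewrite big_cons Pi; last exact: IH.
exact: (exp_boundedM (hf i) IH).
Qed.

Lemma exp_bounded_trans h k c f : 0 <= c -> (forall y, h y <= c * k y) ->
  exp_bounded h f -> exp_bounded k f.
Proof.
move=> c0 hk [A [K [A0 K0 fA]]]; exists A, (K * c); split => // [|y].
  exact: mulr_ge0.
by rewrite (le_trans (fA y))// ler_wpM2l// ler_expR -mulrA ler_wpM2l.
Qed.

End exp_bounded.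

Section sum_normr.
Context {R : realType} {Y : Type} {D : nat}.
Implicit Types (w : 'I_D -> Y -> R).

Definition sum_normr w (y : Y) : R := \sum_l `|w l y|.

Lemma sum_normr_ge0 w y : 0 <= sum_normr w y.
Proof. exact: sumr_ge0. Qed.

Lemma normr_le_sum_normr w l y : `|w l y| <= sum_normr w y.
Proof. by rewrite /sum_normr (bigD1 l)//= lerDl sumr_ge0. Qed.

End sum_normr.

Lemma measurable_sum_normr (R : realType) d (Y : measurableType d) D
    (w : 'I_D -> Y -> R) :
  (forall l, measurable_fun setT (w l)) -> measurable_fun setT (sum_normr w).
Proof. by move=> mw; apply: measurable_sum => l; exact: measurableT_comp. Qed.

Section exp_moments.
Context {R : realType} d (Y : measurableType d) (P : {measure set Y -> \bar R}).
Implicit Types (f h k : Y -> R) (c : R).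

Definition exp_moments h :=
  forall K : R, P.-integrable setT (fun y => (expR (K * h y))%:E).

Lemma integrable_exp_bounded h f : exp_moments h -> measurable_fun setT f ->
  exp_bounded h f -> P.-integrable setT (EFin \o f).
Proof.
move=> momh mf [A [K [A0 K0 fA]]].
apply: (le_integrable _ _ _ (integrableZl measurableT A (momh K))) => //.
  exact/measurable_EFinP.
by move=> y _; rewrite -EFinM lee_fin (le_trans (fA y))// ler_norm.
Qed.

Lemma exp_moments_le h k c : 0 <= c -> measurable_fun setT h ->
  (forall y, 0 <= h y <= c * k y) -> exp_moments k -> exp_moments h.
Proof.
move=> c0 mh hk momk K; apply: (@integrable_exp_bounded k) => //.
  by apply: measurableT_comp => //; exact: measurable_funM.
exists 1, (`|K| * c); split => [//||y]; first exact: mulr_ge0.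
have /andP[h0 hck] := hk y; rewrite ger0_norm ?expR_ge0// mul1r ler_expR.
by rewrite -mulrA (le_trans (ler_wpM2r h0 (ler_norm K)))// ler_wpM2l.
Qed.

End exp_moments.

Lemma normr_horner_le (R : numDomainType) (p q : {poly R}) (x y : R) :
  (forall i, `|p`_i| <= q`_i) -> `|x| <= y -> `|p.[x]| <= q.[y].
Proof.
move=> pq xy; have sizeq := leq_maxr (size p) (size q).
rewrite (horner_coef_wide _ (leq_maxl (size p) (size q))) (horner_coef_wide _ sizeq).
apply: (le_trans (ler_norm_sum _ _ _)); apply: ler_sum => i _.
rewrite normrM normrX ler_pM// lerXn2r ?nnegrE//.
exact: le_trans xy.
Qed.

Lemma taylor_partial_sum_le (R : realType) (g : nat -> R -> R) (x t : R) N : x <= t ->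
  (forall n u, x <= u -> is_derive u 1 (g n) (g n.+1 u)) ->
  (forall n u, x <= u -> 0 <= g n u) ->
  \sum_(n < N) g n x / n`!%:R * (t - x) ^+ n <= g 0%N t.
Proof.
move=> xt; elim: N g t xt => [|N IH] g t xt dg g0; first by rewrite big_ord0 g0.
pose p : {poly R} := \poly_(n < N.+1) (g n x / n`!%:R).
have dpE : p^`() = \poly_(n < N) (g n.+1 x / n`!%:R).
  apply/polyP => n; rewrite coef_deriv !coef_poly ltnS.
  case: ifP => _; last exact: mul0rn.
  rewrite factS natrM -mulr_natr; field.
  by rewrite nat1r !pnatr_eq0 -lt0n fact_gt0.
pose remainder := g 0%N - (horner p \o shift (- x)).
have dremainder u : x <= u ->
    is_derive u 1 remainder (g 1%N u - p^`().[u - x]).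
  move=> xu; apply: is_deriveB; first exact: dg.
  apply: (is_derive_eq (is_derive1_comp (is_derive_poly p _) (is_derive_shift _ _ _))).
  exact: mulr1.
have : remainder x <= remainder t.
  apply: (@ger0_derive1_ndecry _ _ x) => //.
  - by move=> u /[!in_itv]/= /andP[/ltW/dremainder du _].
  - move=> u /[!in_itv]/= /andP[/ltW xu _]; have du := dremainder _ xu.
    rewrite derive1E derive_val subr_ge0 dpE horner_poly.
    by apply: (IH (fun n => g n.+1)) => // n; exact: g0.
  - apply: derivable_within_continuous => u /[!in_itv]/= /andP[xu _].
    by have du := dremainder _ xu.
rewrite /remainder !fctE /= subrr horner_coef0 coef_poly /= fact0 divr1 subrr.
by rewrite subr_ge0 horner_poly.
Qed.

Section hermite.
Context {R : realType}.
Implicit Types (n N : nat) (e s w C : R).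

(* [e = -1] gives the Hermite polynomials of probability theory, [e = 0] the
   powers of ['X], and [e = 1] the polynomials with the absolute values of the
   coefficients of the Hermite polynomials. *)
Definition hermite e n : {poly R} := iter n (fun p => 'X * p + e *: p^`()) 1.

Definition hermite_exp e s n w : R :=
  expR (s * w + e * s ^+ 2 / 2) * (hermite e n).[w + e * s].

Lemma hermite_e0 n : hermite 0 n = 'X^n.
Proof. by elim: n => //= n ->; rewrite scale0r addr0 -exprS. Qed.

Lemma hermite_exp_e0 s n w : hermite_exp 0 s n w = expR (s * w) * w ^+ n.
Proof. by rewrite /hermite_exp !mul0r !addr0 hermite_e0 hornerXn. Qed.

Lemma hermite_exp_n0 e s w : hermite_exp e s 0 w = expR (s * w + e * s ^+ 2 / 2).
Proof. by rewrite /hermite_exp hornerC mulr1. Qed.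

Lemma is_derive_hermite_exp e s n w :
  is_derive s 1 (fun s => hermite_exp e s n w) (hermite_exp e s n.+1 w).
Proof.
have dlin : is_derive s 1 (fun s => w + e * s) e.
  by apply: is_derive_eq; rewrite ?add0r /GRing.scale /=; ring.
have dquad : is_derive s 1 (fun s => s * w + e * s ^+ 2 / 2) (w + e * s).
  by apply: is_derive_eq; rewrite /GRing.scale /=; field.
have dexp := is_derive1_comp (is_derive_expR _) dquad.
have dpoly := is_derive1_comp (is_derive_poly (hermite e n) _) dlin.
apply: (is_derive_eq (is_deriveM dexp dpoly)).
by rewrite /hermite_exp /= !hornerE /GRing.scale /=; ring.
Qed.

Lemma measurable_hermite_exp e s n : measurable_fun [set: R] (hermite_exp e s n).
Proof.
apply: measurable_funM.
  by apply: measurableT_comp => //; apply: measurable_funD.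
apply: (measurableT_comp (f := horner (hermite e n))).
  exact: measurable_poly.
exact: measurable_funD.
Qed.

Lemma normr_coef_hermite_le e n i : `|(hermite e n)`_i| <= (hermite `|e| n)`_i.
Proof.
elim: n i => [|n IH] i /=; first by rewrite coef1 normr_nat.
rewrite !coefD !coefXM !coefZ !coef_deriv (le_trans (ler_normD _ _))//.
rewrite lerD ?normrM ?normrMn ?ler_wpM2l ?lerMn2r ?IH ?orbT//.
by case: i => [|i] /=; rewrite ?normr0 ?IH.
Qed.

Lemma normr_hermite_exp_le e s S n w : `|s| <= S ->
  `|hermite_exp e s n w| <= hermite_exp `|e| S n `|w|.
Proof.
move=> sS; rewrite /hermite_exp normrM (ger0_norm (expR_ge0 _)) ler_pM ?expR_ge0//.
  have S0 : 0 <= S by exact: le_trans sS.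
  rewrite ler_expR; apply: lerD; rewrite ?ler_wpM2r// (le_trans (ler_norm _))// normrM.
    by rewrite ler_wpM2r.
  by rewrite normrX ler_wpM2l// lerXn2r.
apply: normr_horner_le; first exact: normr_coef_hermite_le.
by rewrite (le_trans (ler_normD _ _))// lerD// normrM ler_wpM2l.
Qed.

Lemma hermite_exp_ge0 e s n w : 0 <= e -> 0 <= s -> 0 <= w ->
  0 <= hermite_exp e s n w.
Proof.
move=> e0 s0 w0; have := normr_hermite_exp_le e n w (lexx `|s|).
by rewrite (ger0_norm e0) (ger0_norm s0) (ger0_norm w0); exact: le_trans.
Qed.

Lemma hermite_exp_egf_le e s w C N : 0 <= e -> 0 <= s -> 0 <= w -> 0 <= C ->
  \sum_(n < N) hermite_exp e s n w / n`!%:R * C ^+ n <= hermite_exp e (s + C) 0 w.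
Proof.
move=> e0 s0 w0 C_ge0; rewrite -{1}(addKr s C) addrC.
apply: (@taylor_partial_sum_le _ (fun n s => hermite_exp e s n w)) => [|n u _|n u su].
- by rewrite lerDl.
- exact: is_derive_hermite_exp.
- by rewrite hermite_exp_ge0// (le_trans s0).
Qed.

Lemma normr_hermite_exp_le_fact e s S n w : `|s| <= S ->
  `|hermite_exp e s n w| <= n`!%:R * hermite_exp `|e| (S + 1) 0 `|w|.
Proof.
move=> sS; have S0 : 0 <= S by exact: le_trans sS.
apply: (le_trans (normr_hermite_exp_le _ _ _ sS)).
rewrite mulrC -ler_pdivrMr ?ltr0n ?fact_gt0//.
apply: le_trans (hermite_exp_egf_le n.+1 _ S0 _ ler01) => //.
rewrite big_ord_recr /= expr1n mulr1 lerDr sumr_ge0// => i _.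
by rewrite mulr_ge0 ?divr_ge0 ?exprn_ge0 ?hermite_exp_ge0.
Qed.

End hermite.

Section hermite_moments.
Context {R : realType} d (Y : measurableType d) (P : {measure set Y -> \bar R}).
Implicit Types (e s : R) (h u Q : Y -> R).

Lemma exp_bounded_hermite_exp e s n h u : (forall y, `|u y| <= h y) ->
  exp_bounded h (fun y => hermite_exp e s n (u y)).
Proof.
move=> uh; apply: (@exp_bounded_trans _ _ (fun y => `|u y|) _ 1) => // [y|].
  by rewrite mul1r.
exists (n`!%:R * expR (`|e| * (`|s| + 1) ^+ 2 / 2)), (`|s| + 1); split => [||y].
- by rewrite mulr_ge0 ?expR_ge0.
- by rewrite addr_ge0.
- rewrite -mulrA -expRD [X in expR X]addrC -hermite_exp_n0.
  exact: normr_hermite_exp_le_fact.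
Qed.

Lemma derive1_Rintegral_hermite_exp e s n h u Q : exp_moments P h ->
  measurable_fun setT u -> (forall y, `|u y| <= h y) ->
  measurable_fun setT Q -> exp_bounded h Q ->
  derive1 (fun s => \int[P]_y (hermite_exp e s n (u y) * Q y)) s =
  \int[P]_y (hermite_exp e s n.+1 (u y) * Q y).
Proof.
move=> momh mu uh mQ hQ; pose f x y := hermite_exp e x n (u y) * Q y.
have df (x : R) (y : Y) :
    is_derive x (1 : R) (f^~ y) (hermite_exp e x n.+1 (u y) * Q y).
  have dQ := is_derive_cst (Q y) x (1 : R).
  have dM := is_deriveM (is_derive_hermite_exp e x n (u y)) dQ.
  by apply: (is_derive_eq dM); rewrite scaler0 add0r /GRing.scale /= mulrC.
have partialE x y : partial1of2 f x y = hermite_exp e x n.+1 (u y) * Q y.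
  by rewrite partial1of2E; have dfx := df x y; rewrite derive_val.
pose S := `|s| + 1.
have itvS x : `]s - 1, s + 1[%classic x -> `|x| <= S.
  rewrite /= in_itv /= => xs; rewrite -(subrK s x) addrC (le_trans (ler_normD _ _))//.
  by rewrite lerD// ltW// ltr_distlC; move: xs; lra.
have mhermite x k : measurable_fun setT (fun y => hermite_exp e x k (u y)).
  exact: (measurableT_comp (measurable_hermite_exp _ _ _)).
have hhermite x k : exp_bounded h (fun y => hermite_exp e x k (u y)).
  exact: exp_bounded_hermite_exp.
pose dominant y := n.+1`!%:R * hermite_exp `|e| (S + 1) 0 `|u y| * `|Q y|.
transitivity (\int[P]_y partial1of2 f s y); last first.
  by apply: eq_Rintegral => y _; exact: partialE.
apply: (@differentiation_under_integral _ _ _ P f _ measurableT s (s - 1) (s + 1)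
    _ _ _ dominant) => [|x _|x y _ _|y||x y /itvS xS _].
- by rewrite /= in_itv /=; lra.
- apply: (integrable_exp_bounded momh); first exact: measurable_funM.
  exact: exp_boundedM.
- by have dfx := df x y.
- by rewrite mulr_ge0// mulr_ge0// hermite_exp_ge0// !addr_ge0.
- apply: (integrable_exp_bounded momh).
    apply: measurable_funM; last exact: measurableT_comp.
    apply: measurable_funM => //.
    apply: (measurableT_comp (measurable_hermite_exp _ _ _)).
    exact: measurableT_comp.
  apply: exp_boundedM; last exact: exp_bounded_norm.
  apply: exp_boundedM; first exact: exp_bounded_cst.
  by apply: exp_bounded_hermite_exp => y; rewrite normr_id.
- by rewrite partialE normrM ler_wpM2r// normr_hermite_exp_le_fact.
Qed.

Lemma Rintegral_hermite_exp_moment e h u Q (m c : R) : exp_moments P h ->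
  measurable_fun setT u -> (forall y, `|u y| <= h y) ->
  measurable_fun setT Q -> exp_bounded h Q ->
  (forall s, \int[P]_y (hermite_exp e s 0 (u y) * Q y) = hermite_exp 0 s 0 m * c) ->
  forall s n, \int[P]_y (hermite_exp e s n (u y) * Q y) = hermite_exp 0 s n m * c.
Proof.
move=> momh mu uh mQ hQ mgf s n; elim: n s => // n IH s.
rewrite -(derive1_Rintegral_hermite_exp _ _ _ momh)//.
rewrite (_ : (fun s => _) = (fun s => hermite_exp 0 s n m) * cst c); last exact/funext.
have dh := is_deriveM (is_derive_hermite_exp 0 s n m) (is_derive_cst c s (1 : R)).
by rewrite derive1E derive_val scaler0 add0r /GRing.scale /= mulrC.
Qed.

Variables (D : nat) (w : 'I_D -> Y -> R).
Hypothesis mw : forall l, measurable_fun setT (w l).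
Implicit Types (a : 'I_D -> R) (n : 'I_D -> nat).

Lemma measurable_hermite_prod e a n (A : pred 'I_D) :
  measurable_fun setT (fun y => \prod_(l | A l) hermite_exp e (a l) (n l) (w l y)).
Proof.
under eq_fun do rewrite -big_filter.
apply: measurable_prod => l _.
exact: (measurableT_comp (measurable_hermite_exp _ _ _)).
Qed.

Lemma exp_bounded_hermite_prod e a n (A : pred 'I_D) :
  exp_bounded (sum_normr w)
    (fun y => \prod_(l | A l) hermite_exp e (a l) (n l) (w l y)).
Proof.
apply: exp_bounded_prod => l; apply: exp_bounded_hermite_exp.
exact: normr_le_sum_normr.
Qed.

Hypothesis exp_moments_w : exp_moments P (sum_normr w).

Lemma Rintegral_hermite_prod e (m : 'I_D -> R) :
  (forall a, \int[P]_y \prod_l hermite_exp e (a l) 0 (w l y) =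
             \prod_l hermite_exp 0 (a l) 0 (m l)) ->
  forall a n, \int[P]_y \prod_l hermite_exp e (a l) (n l) (w l y) =
              \prod_l hermite_exp 0 (a l) (n l) (m l).
Proof.
move=> mgf a n; have [k] := ubnP #|[pred l | n l != 0%N]|.
elim: k n a => // k IH n a nk.
have [/existsP[l nl0]|/existsPn n0] := boolP [exists l, n l != 0%N]; last first.
  by rewrite (_ : n = fun=> 0%N)//; apply/funext => l; exact/eqP/negPn.
under eq_Rintegral do rewrite (bigD1 l)//=; rewrite [RHS](bigD1 l)//=.
apply: (Rintegral_hermite_exp_moment exp_moments_w) => // [|||x].
- exact: normr_le_sum_normr.
- exact: measurable_hermite_prod.
- exact: exp_bounded_hermite_prod.
pose a' := dfwith a l x; pose n' := dfwith n l 0%N.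
have prodE e' (z : 'I_D -> R) :
    hermite_exp e' x 0 (z l) * \prod_(j | j != l) hermite_exp e' (a j) (n j) (z j) =
    \prod_j hermite_exp e' (a' j) (n' j) (z j).
  rewrite [RHS](bigD1 l)//= /a' /n' !dfwithin; congr (_ * _).
  by apply: eq_bigr => j jl; rewrite !dfwithout// eq_sym.
rewrite prodE; under eq_Rintegral do rewrite (prodE e (w^~ _)).
apply: IH; rewrite -ltnS; apply: leq_trans nk; rewrite ltnS.
apply/proper_card/properP; split; last first.
  by exists l; rewrite // inE /n' dfwithin.
apply/fintype.subsetP => j; rewrite !inE /n'; have [->|jl] := eqVneq j l => //.
by rewrite dfwithout// eq_sym.
Qed.

End hermite_moments.

Section multi_index.
Context {R : realType} {D : nat}.
Implicit Types (p : mindex D) (C : R).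

Definition mindex_box N : seq (mindex D) :=
  [seq [ffun l => h l : nat] | h : {ffun 'I_D -> 'I_N}].

Lemma mindex_box_uniq N : uniq (mindex_box N).
Proof.
rewrite map_inj_uniq ?enum_uniq// => g h /ffunP gh; apply/ffunP => l.
by apply: val_inj; have := gh l; rewrite !ffunE.
Qed.

Lemma finite_mindex_sub_box (X : set (mindex D)) : finite_set X ->
  exists N, X `<=` [set` mindex_box N].
Proof.
move=> finX; exists (\max_(p <- finmap.enum_fset (fset_set X)) \max_l p l).+1 => p Xp.
apply/mapP; exists [ffun l => inord (p l)]; first exact: mem_enum.
apply/ffunP => l; rewrite !ffunE inordK// ltnS.
apply: (@leq_trans (\max_l p l)); first exact: (leq_bigmax l).
by apply: leq_bigmax_seq => //; rewrite in_fset_set// inE.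
Qed.

Lemma esum_mindex_prod_le (f : 'I_D -> nat -> R) (b : 'I_D -> R) :
  (forall l n, 0 <= f l n) -> (forall l N, \sum_(n < N) f l n <= b l) ->
  (\esum_(p in [set: mindex D]) (\prod_l f l (p l))%:E <= (\prod_l b l)%:E)%E.
Proof.
move=> f0 fb; apply: ge_ereal_sup => _ [X [finX _] <-].
have [N XN] := finite_mindex_sub_box finX.
apply: (@le_trans _ _ (\sum_(p \in [set` mindex_box N]) (\prod_l f l (p l))%:E)%E).
  apply: lee_fsum_nneg_subset => // [|p|p _].
  - exact: finite_seq.
  - by rewrite !inE; exact: XN.
  - by rewrite lee_fin prodr_ge0.
rewrite -fsbig_seq ?mindex_box_uniq//= sumEFin lee_fin big_map big_enum/=.
under eq_bigr do under eq_bigr do rewrite ffunE.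
rewrite -(bigA_distr_bigA (fun l (n : 'I_N) => f l n)).
by apply: ler_prod => l _; rewrite fb andbT; exact: sumr_ge0.
Qed.

Lemma expr_mabs_div_mfact C p :
  C ^+ mabs p / (mfact p)%:R = \prod_l (C ^+ p l / (p l)`!%:R).
Proof. by rewrite prodf_div expr_sum natr_prod. Qed.

End multi_index.

Section hermite_series.
Context {R : realType} {D : nat}.
Implicit Types (e : R) (s z : 'I_D -> R) (p : mindex D).

Definition hermite_term e (a : mindex D -> R) s z p : R :=
  a p / (mfact p)%:R * \prod_l hermite_exp e (s l) (p l) (z l).

Definition hermite_series e a s z : R := csum (hermite_term e a s z).

Variables (a : mindex D -> R) (C : R).
Hypothesis C_ge0 : 0 <= C.
Hypothesis a_le : forall p, `|a p| <= C ^+ mabs p.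

Lemma esum_hermite_term_le e s z :
  (\esum_(p in [set: mindex D]) `|hermite_term e a s z p|%:E <=
   (\prod_l hermite_exp `|e| (`|s l| + C) 0 `|z l|)%:E)%E.
Proof.
apply: le_trans (esum_mindex_prod_le
  (f := fun l n => hermite_exp `|e| `|s l| n `|z l| / n`!%:R * C ^+ n) _ _).
- apply: le_esum => p _; rewrite lee_fin.
  under [leRHS]eq_bigr do rewrite mulrAC -mulrA.
  rewrite big_split /= -expr_mabs_div_mfact /hermite_term normrM [leLHS]mulrC.
  rewrite ler_pM//.
    rewrite normr_prod; apply: ler_prod => l _.
    by rewrite normr_ge0 normr_hermite_exp_le.
  by rewrite normrM normfV normr_nat ler_wpM2r.
- by move=> l n; rewrite mulr_ge0 ?divr_ge0 ?hermite_exp_ge0 ?exprn_ge0.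
- by move=> l N; exact: hermite_exp_egf_le.
Qed.

Lemma summable_hermite_term e s z :
  summable [set: mindex D] (EFin \o hermite_term e a s z).
Proof. exact: le_lt_trans (esum_hermite_term_le e s z) (ltry _). Qed.

Lemma normr_hermite_series_le e s z :
  `|hermite_series e a s z| <= \prod_l hermite_exp `|e| (`|s l| + C) 0 `|z l|.
Proof. exact/normr_csum_le/esum_hermite_term_le. Qed.

Lemma hermite_series_e0 s z : hermite_series 0 a s z =
  expR (\sum_l s l * z l) * csum (fun p => a p / (mfact p)%:R * \prod_l z l ^+ p l).
Proof.
have term0 p : hermite_term 0 a (fun=> 0) z p = a p / (mfact p)%:R * \prod_l z l ^+ p l.
  by congr (_ * _); apply: eq_bigr => l _; rewrite hermite_exp_e0 mul0r expR0 mul1r.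
have -> : (fun p => a p / (mfact p)%:R * \prod_l z l ^+ p l) =
    hermite_term 0 a (fun=> 0) z by apply/funext => p; rewrite term0.
rewrite -csumZl; last exact: summable_hermite_term.
congr csum; apply/funext => p; rewrite term0 /hermite_term mulrCA expR_sum -big_split.
by congr (_ * _); apply: eq_bigr => l _; exact: hermite_exp_e0.
Qed.

Context d (Y : measurableType d) (P : {sigma_finite_measure set Y -> \bar R}).
Variable w : 'I_D -> Y -> R.
Hypothesis mw : forall l, measurable_fun setT (w l).

Let measurable_hermite_term e s p :
  measurable_fun setT (fun y => hermite_term e a s (w^~ y) p).
Proof. by apply: measurable_funM => //; exact: measurable_hermite_prod. Qed.

Lemma measurable_hermite_series e s :
  measurable_fun setT (fun y => hermite_series e a s (w^~ y)).
Proof. exact: (measurable_csum (measurable_hermite_term e s)). Qed.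

Let dominant e s y := \prod_l hermite_exp `|e| (`|s l| + C) 0 `|w l y|.

Let measurable_dominant e s : measurable_fun setT (dominant e s).
Proof.
apply: (measurable_hermite_prod (w := fun l y => `|w l y|)) => l.
exact: measurableT_comp.
Qed.

Let exp_bounded_dominant e s : exp_bounded (sum_normr w) (dominant e s).
Proof.
apply: exp_bounded_prod => l; apply: exp_bounded_hermite_exp => y.
by rewrite normr_id normr_le_sum_normr.
Qed.

Lemma exp_bounded_hermite_series e s :
  exp_bounded (sum_normr w) (fun y => hermite_series e a s (w^~ y)).
Proof.
have [A [K [A0 K0 dominantA]]] := exp_bounded_dominant e s.
exists A, K; split => // y; apply: le_trans (dominantA y).
by rewrite (le_trans (normr_hermite_series_le _ _ _))// ler_norm.
Qed.

Hypothesis exp_moments_w : exp_moments P (sum_normr w).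

Lemma Rintegral_hermite_series e (m s : 'I_D -> R) :
  (forall s, \int[P]_y \prod_l hermite_exp e (s l) 0 (w l y) =
             \prod_l hermite_exp 0 (s l) 0 (m l)) ->
  \int[P]_y hermite_series e a s (w^~ y) = hermite_series 0 a s m.
Proof.
move=> mgf; rewrite (Rintegral_csum (B := dominant e s)); last 3 first.
- exact: measurable_hermite_term.
- by move=> y; exact: esum_hermite_term_le.
- exact: integrable_exp_bounded exp_moments_w (measurable_dominant e s)
    (exp_bounded_dominant e s).
congr csum; apply/funext => p; rewrite /hermite_term RintegralZl//.
  by rewrite (Rintegral_hermite_prod mw exp_moments_w mgf).
apply: integrable_exp_bounded exp_moments_w _ _.
  exact: measurable_hermite_prod.
exact: exp_bounded_hermite_prod.
Qed.

End hermite_series.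

Section normal_integral.
Context {R : realType}.
Local Notation mu := (@lebesgue_measure R).
Implicit Types m s c : R.

Lemma ge0_integral_normal_prob m s (f : R -> \bar R) :
  measurable_fun [set: R] f -> (forall x, 0 <= f x)%E ->
  (\int[normal_prob m s]_x f x = \int[mu]_x (f x * (normal_pdf m s x)%:E))%E.
Proof.
move=> mf f0.
have dom := @normal_prob_dominates R m s.
have mpdf : measurable_fun [set: R] (EFin \o normal_pdf m s).
  by apply/measurable_EFinP; exact: measurable_normal_pdf.
have intRN := Radon_Nikodym_SigmaFinite.f_integrable dom.
rewrite -(Radon_Nikodym_SigmaFinite.change_of_variables dom)//.
apply: ae_eq_integral => //.
- by apply: emeasurable_funM => //; exact: measurable_int intRN.
- exact: emeasurable_funM.
- apply: ae_eqe_mul2l; apply: integral_ae_eq => //= E _ mE.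
  by rewrite -Radon_Nikodym_SigmaFinite.f_integral.
Qed.

Lemma measurable_expRM c : measurable_fun [set: R] (fun x => expR (c * x)).
Proof. by apply: measurableT_comp => //; exact: mulrl_measurable. Qed.

Lemma expR_normal_pdf m s c x : s != 0 ->
  expR (c * x) * normal_pdf m s x =
  expR (c * m + c ^+ 2 * s ^+ 2 / 2) * normal_pdf (m + c * s ^+ 2) s x.
Proof.
move=> s0; rewrite !normal_pdfE// mulrCA [RHS]mulrCA; congr *%R.
rewrite /normal_fun -!expRD; congr expR.
by rewrite -!(mulr_natl (_ ^+ 2)); field.
Qed.

Lemma normal_prob_mgf m s c : s != 0 ->
  (\int[normal_prob m s]_x (expR (c * x))%:E =
   (expR (c * m + c ^+ 2 * s ^+ 2 / 2))%:E)%E.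
Proof.
move=> s0; rewrite ge0_integral_normal_prob//; last first.
  by apply/measurable_EFinP; exact: measurable_expRM.
under eq_integral do rewrite -EFinM expR_normal_pdf// EFinM.
by rewrite integralZl ?integral_normal_pdf ?mule1//; exact: integrable_normal_pdf.
Qed.

Lemma normal_prob_expR_norm_lty m s c : s != 0 ->
  (\int[normal_prob m s]_x (expR (c * `|x|))%:E < +oo)%E.
Proof.
move=> s0; have mexp a : measurable_fun [set: R] (fun x => (expR (a * x))%:E).
  by apply/measurable_EFinP; exact: measurable_expRM.
apply: (@le_lt_trans _ _
  (\int[normal_prob m s]_x ((expR (c * x))%:E + (expR (- c * x))%:E))%E).
  apply: ge0_le_integral => //.
  - by apply: (measurableT_comp (mexp c)); exact: normr_measurable.
  - by apply: emeasurable_funD; exact: mexp.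
  - move=> x _; rewrite -EFinD lee_fin.
    have [x0|x0] := ger0P x; first by rewrite lerDl expR_ge0.
    by rewrite mulrN -mulNr lerDr expR_ge0.
rewrite ge0_integralD//; [|exact: mexp..].
by rewrite !normal_prob_mgf// -EFinD ltry.
Qed.

End normal_integral.

Section gauss_prob.
Context {R : realType}.
Implicit Types (s : R) (n : nat).

Definition tuple_cons n (z : measurableTypeR R * n.-tuple R) : n.+1.-tuple R :=
  [tuple of z.1 :: z.2].

Lemma measurable_tuple_cons n : measurable_fun setT (@tuple_cons n).
Proof. exact: measurable_cons. Qed.

HB.instance Definition _ n :=
  isMeasurableFun.Build _ _ _ _ (@tuple_cons n) (@measurable_tuple_cons n).

Fixpoint gauss_prob s n : n.-tuple R -> probability (n.-tuple R) R :=
  match n with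
  | 0 => fun=> \d_([tuple] : 0.-tuple R)
  | n'.+1 => fun m =>
      distribution (normal_prob (thead m) s \x gauss_prob s (behead_tuple m))%E
        (@tuple_cons n')
  end.

Lemma ge0_integral_gauss_probS s n (m : n.+1.-tuple R) (f : n.+1.-tuple R -> \bar R) :
  measurable_fun setT f -> (forall t, 0 <= f t)%E ->
  (\int[gauss_prob s m]_t f t =
   \int[normal_prob (thead m) s]_x \int[gauss_prob s (behead_tuple m)]_u
     f [tuple of x :: u])%E.
Proof.
move=> mf f0; rewrite ge0_integral_distribution// fubini_tonelli1//=.
exact: measurableT_comp.
Qed.

Lemma measurable_gauss_iter d (T : measurableType d) s n (m : n.-tuple R)
    (F : T * n.-tuple R -> \bar R) :
  measurable_fun setT F ->
  measurable_fun setT (fun z => gauss_iter s m (fun u => F (z, u))).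
Proof.
elim: n d T m F => [|n IH] d T m F mF; first exact: measurableT_comp.
pose G z := gauss_iter s (behead_tuple m)
  (fun u => F (z.1, [tuple of z.2 :: u] : n.+1.-tuple R)).
have mG : measurable_fun [set: T * measurableTypeR R] G.
  apply: (IH _ _ _ (fun y => F (y.1.1, [tuple of y.1.2 :: y.2]))).
  apply: (measurableT_comp mF); apply: measurable_fun_pair => /=.
    exact: measurableT_comp.
  by apply: measurable_cons => //; exact: measurableT_comp.
exact: (measurable_fun_integral (normal_prob (thead m) s) mG).
Qed.

Lemma gauss_iterE s n (m : n.-tuple R) (f : n.-tuple R -> \bar R) :
  (gauss_prob s m).-integrable setT f ->
  gauss_iter s m f = (\int[gauss_prob s m]_t f t)%E.
Proof.
elim: n m f => [|n IH] m f intf; have mf := measurable_int _ intf.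
  by rewrite integral_dirac// diracT mul1e.
have intfX : (normal_prob (thead m) s \x gauss_prob s (behead_tuple m))%E
    .-integrable setT (f \o @tuple_cons n).
  apply/integrableP; split; first exact: measurableT_comp.
  have /integrableP[_] := intf; rewrite ge0_integral_distribution//.
  exact: measurableT_comp.
rewrite integral_distribution// -integral12_prod_meas1//=.
apply: ae_eq_integral => //.
- apply: (measurable_gauss_iter _ _ (F := f \o @tuple_cons n)).
  exact: measurableT_comp.
- exact: measurable_fubini_F intfX.
- apply: filterS (ae_integrable1 intfX) => x intfx _.
  exact: (IH _ (fun u => f [tuple of x :: u])).
Qed.

Lemma measurable_prod_tnth n (g : 'I_n -> R -> R) :
  (forall i, measurable_fun setT (g i)) ->
  measurable_fun setT (fun t : n.-tuple R => \prod_i g i (tnth t i)).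
Proof.
move=> mg; apply: measurable_prod => i _.
exact: (measurableT_comp (mg i) (measurable_tnth i)).
Qed.

Lemma integral_gauss_prob_prod s n (m : n.-tuple R) (g : 'I_n -> R -> R)
    (c : 'I_n -> R) :
  (forall i, measurable_fun setT (g i)) -> (forall i x, 0 <= g i x) ->
  (forall i, \int[normal_prob (tnth m i) s]_x (g i x)%:E = (c i)%:E)%E ->
  (\int[gauss_prob s m]_t (\prod_i g i (tnth t i))%:E = (\prod_i c i)%:E)%E.
Proof.
elim: n m g c => [|n IH] m g c mg g0 gc.
  under eq_integral do rewrite big_ord0.
  by rewrite integral_dirac// diracT mul1e big_ord0.
pose tail_prod (u : n.-tuple R) := \prod_i g (lift ord0 i) (tnth u i).
have tail_prod_ge0 u : (0 <= (tail_prod u)%:E)%E by rewrite lee_fin prodr_ge0.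
have int_tail : (\int[gauss_prob s (behead_tuple m)]_u (tail_prod u)%:E =
    (\prod_(i < n) c (lift ord0 i))%:E)%E.
  apply: (IH _ (fun i => g (lift ord0 i))) => // i.
  by rewrite -gc [in RHS](tuple_eta m) tnthS.
have consE x (u : n.-tuple R) : (\prod_i g i (tnth [tuple of x :: u] i))%:E =
    ((g ord0 x)%:E * (tail_prod u)%:E)%E.
  rewrite big_ord_recl tnth0 EFinM.
  by congr (_ * (_)%:E)%E; apply: eq_bigr => i _; rewrite tnthS.
rewrite ge0_integral_gauss_probS; last 2 first.
- by apply/measurable_EFinP; exact: measurable_prod_tnth.
- by move=> t; rewrite lee_fin prodr_ge0.
under eq_integral => x _.
  under eq_integral do rewrite consE.
  rewrite ge0_integralZl_EFin//; last first.
    apply/measurable_EFinP.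
    exact: (measurable_prod_tnth (fun i => mg (lift ord0 i))).
  rewrite int_tail muleC.
  over.
rewrite ge0_integralZl//; last 3 first.
- by apply/measurable_EFinP; exact: (mg ord0).
- by move=> x _; rewrite lee_fin.
- by rewrite -int_tail integral_ge0.
by rewrite (gc ord0) -EFinM big_ord_recl mulrC.
Qed.

End gauss_prob.

Section gauss_moments.
Context {R : realType}.
Implicit Types (s : R) (n : nat).

Definition norm1 n : n.-tuple R -> R := sum_normr (fun i t => tnth t i).

Lemma measurable_norm1 n : measurable_fun setT (@norm1 n).
Proof. by apply: measurable_sum_normr => i; exact: measurable_tnth. Qed.

Lemma gauss_prob_exp_moments s n (m : n.-tuple R) : s != 0 ->
  exp_moments (gauss_prob s m) (@norm1 n).
Proof.
move=> s0 K; apply/integrableP; split.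
  apply/measurable_EFinP; apply: measurableT_comp => //.
  by apply: measurable_funM => //; exact: measurable_norm1.
under eq_integral do rewrite gee0_abs// /norm1 /sum_normr mulr_sumr expR_sum.
pose c i := fine (\int[normal_prob (tnth m i) s]_x (expR (K * `|x|))%:E).
rewrite (integral_gauss_prob_prod (g := fun _ x => expR (K * `|x|)) (c := c)) ?ltry//.
- by move=> _; apply: (measurableT_comp (measurable_expRM K)); exact: normr_measurable.
- move=> i; rewrite fineK// ge0_fin_numE ?normal_prob_expR_norm_lty//.
  exact: integral_ge0.
Qed.

Lemma integrable_gauss_prob_exp_bounded s n (m : n.-tuple R) (f : n.-tuple R -> R) :
  s != 0 -> measurable_fun setT f -> exp_bounded (@norm1 n) f ->
  (gauss_prob s m).-integrable setT (EFin \o f).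
Proof. by move=> s0; exact: integrable_exp_bounded (gauss_prob_exp_moments m s0). Qed.

Lemma gauss_prob_mgf s n (m : n.-tuple R) (v : 'cV[R]_n) : s != 0 ->
  (\int[gauss_prob s m]_t (expR ((v^T *m tup2col t) 0 0))%:E =
   (expR ((v^T *m tup2col m) 0 0 + s ^+ 2 / 2 * (v^T *m v) 0 0))%:E)%E.
Proof.
move=> s0.
have dotE (u : 'cV[R]_n) : (v^T *m u) 0 0 = \sum_i v i 0 * u i 0.
  by rewrite mxE; apply: eq_bigr => i _; rewrite mxE.
under eq_integral do rewrite dotE expR_sum.
under eq_integral do under eq_bigr do rewrite mxE.
rewrite (integral_gauss_prob_prod (g := fun i x => expR (v i 0 * x))
  (c := fun i => expR (v i 0 * tnth m i + v i 0 ^+ 2 * s ^+ 2 / 2))) => // [|i|i].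
- rewrite -expR_sum !dotE mulr_sumr -big_split /=; congr (expR _)%:E.
  by apply: eq_bigr => i _; rewrite mxE; ring.
- exact: measurable_expRM.
- exact: normal_prob_mgf.
Qed.

End gauss_moments.

Section coordinates.
Context {R : realType} {n : nat}.

Lemma tup2colK : cancel (@tup2col R n) (@col2tup R n).
Proof. by move=> t; apply: eq_from_tnth => i; rewrite tnth_mktuple mxE. Qed.

Lemma col2tupK : cancel (@col2tup R n) (@tup2col R n).
Proof. by move=> v; apply/colP => i; rewrite mxE tnth_mktuple. Qed.

End coordinates.

Section projection.
Context {R : realType} {M D : nat} (U : 'M[R]_(M, D)).

Definition projection (l : 'I_D) (t : M.-tuple R) : R := (U^T *m tup2col t) l 0.

Lemma projectionE l t : projection l t = \sum_j U j l * tnth t j.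
Proof. by rewrite /projection mxE; apply: eq_bigr => j _; rewrite !mxE. Qed.

Lemma measurable_projection l : measurable_fun setT (projection l).
Proof.
rewrite (_ : projection l = fun t => \sum_j U j l * tnth t j); last first.
  by apply/funext => t; exact: projectionE.
apply: measurable_sum => j.
by apply: measurable_funM => //; exact: measurable_tnth.
Qed.

Let opnorm1 := \sum_l \sum_j `|U j l|.

Let opnorm1_ge0 : 0 <= opnorm1.
Proof. by apply: sumr_ge0 => l _; exact: sumr_ge0. Qed.

Let sum_projection_le t : sum_normr projection t <= opnorm1 * norm1 t.
Proof.
rewrite /sum_normr mulr_suml; apply: ler_sum => l _; rewrite projectionE mulr_suml.
apply: (le_trans (ler_norm_sum _ _ _)); apply: ler_sum => j _.
by rewrite normrM ler_wpM2l//; exact: (normr_le_sum_normr _ j).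
Qed.

Lemma exp_bounded_projection (f : M.-tuple R -> R) :
  exp_bounded (sum_normr projection) f -> exp_bounded (@norm1 R M) f.
Proof. exact: exp_bounded_trans opnorm1_ge0 sum_projection_le. Qed.

Lemma exp_moments_projection (P : {measure set M.-tuple R -> \bar R}) :
  exp_moments P (@norm1 R M) -> exp_moments P (sum_normr projection).
Proof.
apply: (exp_moments_le opnorm1_ge0) => [|t].
  exact: measurable_sum_normr measurable_projection.
by rewrite sum_normr_ge0 sum_projection_le.
Qed.

Hypothesis UTU : U^T *m U = 1%:M.

Lemma Rintegral_projection_mgf sigma (m : M.-tuple R) (s : 'I_D -> R) : sigma != 0 ->
  \int[gauss_prob sigma m]_t
    \prod_l hermite_exp (- sigma ^+ 2) (s l) 0 (projection l t) =
  \prod_l hermite_exp 0 (s l) 0 (projection l m).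
Proof.
move=> sigma0; pose c : 'cV[R]_D := \col_l s l; pose q := sigma ^+ 2 / 2.
have dotE t : ((U *m c)^T *m tup2col t) 0 0 = \sum_l s l * projection l t.
  rewrite trmx_mul -mulmxA mxE; apply: eq_bigr => l _.
  by congr (_ * _); rewrite !mxE.
have sqr_norm : ((U *m c)^T *m (U *m c)) 0 0 = \sum_l s l ^+ 2.
  rewrite trmx_mul mulmxA -(mulmxA c^T) UTU mulmx1 mxE.
  by apply: eq_bigr => l _; rewrite !mxE expr2.
have prodE t : \prod_l hermite_exp (- sigma ^+ 2) (s l) 0 (projection l t) =
    expR (- (q * \sum_l s l ^+ 2)) * expR (((U *m c)^T *m tup2col t) 0 0).
  rewrite dotE -expRD mulr_sumr -sumrN -big_split /= expR_sum.
  by apply: eq_bigr => l _; rewrite hermite_exp_n0; congr expR; rewrite /q; lra.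
rewrite /Rintegral; under eq_integral do rewrite prodE EFinM.
rewrite ge0_integralZl_EFin//; last first.
  apply/measurable_EFinP; apply: measurableT_comp => //.
  under eq_fun do rewrite dotE; apply: measurable_sum => l.
  by apply: measurable_funM => //; exact: measurable_projection.
rewrite gauss_prob_mgf// sqr_norm dotE /= -expRD -/q addrCA addNr addr0.
by rewrite expR_sum; apply: eq_bigr => l _; rewrite hermite_exp_n0 !mul0r addr0.
Qed.

End projection.

Section estimator.
Context {R : realType} {M N : nat}.
Variables (H : 'M[R]_(M, N)) (sigma : R) (x : 'cV[R]_N).
Hypothesis sigma_neq0 : sigma != 0.

Lemma Egauss_integral (f : M.-tuple R -> R) :
  measurable_fun setT f -> exp_bounded (@norm1 R M) f ->
  Egauss H sigma x (fun y => (f (col2tup y))%:E) =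
  (\int[gauss_prob sigma (col2tup (H *m x))]_t (f t)%:E)%E.
Proof.
move=> mf bf; rewrite /Egauss.
under [X in gauss_iter _ _ X]eq_fun do rewrite tup2colK.
by rewrite gauss_iterE//; exact: integrable_gauss_prob_exp_bounded.
Qed.

Lemma Egauss_lty (f : M.-tuple R -> R) :
  measurable_fun setT f -> exp_bounded (@norm1 R M) f ->
  (Egauss H sigma x (fun y => (f (col2tup y))%:E) < +oo)%E.
Proof.
move=> mf bf; rewrite Egauss_integral// ltey_eq.
have intf := integrable_gauss_prob_exp_bounded (col2tup (H *m x)) sigma_neq0 mf bf.
by rewrite (integrable_fin_num measurableT intf).
Qed.

End estimator.

Section valid_bias.
Context {R : realType} {M N : nat}.
Variables (H : 'M[R]_(M, N)) (sigma : R) (S : nat) (k : 'I_N).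
Hypothesis sigma_neq0 : sigma != 0.

Lemma valid_bias_exp_bounded (c : 'cV[R]_N -> R) (x0 : 'cV[R]_N) (f : M.-tuple R -> R) :
  measurable_fun setT f -> exp_bounded (@norm1 R M) f ->
  (forall x, sparse_set S x ->
    \int[gauss_prob sigma (col2tup (H *m x))]_t f t = c x + x k 0) ->
  valid_bias H sigma S k c x0.
Proof.
move=> mf bf meanf; exists (fun y => f (col2tup y)); split.
- by under eq_fun do rewrite tup2colK.
- move=> x _; apply: (Egauss_lty _ _ sigma_neq0 (f := fun t => `|f t|)).
    exact: measurableT_comp.
  exact: exp_bounded_norm.
- rewrite /est_var; set mean := est_mean _ _ _ _.
  apply: (Egauss_lty _ _ sigma_neq0 (f := fun t => (f t - mean) ^+ 2)).
    by apply: measurable_funX; exact: measurable_funB.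
  have bB := exp_boundedB (@sum_normr_ge0 _ _ _ _) bf (exp_bounded_cst _ mean).
  exact: (exp_boundedM bB bB).
- move=> x Sx; rewrite /est_bias /est_mean Egauss_integral//.
  by rewrite -[fine _]/(\int[_]_t f t) meanf// addrK.
Qed.

End valid_bias.

Section thin_svd.
Context {R : realType}.

Lemma MP_pinv_left_inverse m n (A : 'M[R]_(m, n)) (B L : 'M[R]_(n, m)) :
  is_MP_pinv A B -> L *m A = 1%:M -> (A *m L)^T = A *m L -> B = L.
Proof.
move=> [ABA BAB ABT _] LA ALT.
have BA : B *m A = 1%:M by rewrite -[B]mul1mx -LA -2!mulmxA (mulmxA A) ABA.
have AB : A *m B = A *m L.
  rewrite -ABT -{1}[A]mulmx1 -LA mulmxA -(mulmxA _ A B) trmx_mul ABT ALT.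
  by rewrite mulmxA -(mulmxA A B A) BA mulmx1.
by rewrite -[B]mul1mx -LA -mulmxA AB mulmxA LA mul1mx.
Qed.

Lemma thin_svd_pinv M N D (H : 'M[R]_(M, N)) (U : 'M[R]_(M, D)) (Sig : 'M[R]_D)
    (V : 'M[R]_(N, D)) (Hp : 'M[R]_(D, N)) :
  thin_svd H U Sig V -> is_MP_pinv (V *m invmx Sig) Hp -> Hp = U^T *m H.
Proof.
move=> [UU VV diagS Spos HE] pinv.
have uS : Sig \in unitmx.
  rewrite unitmxE det_trig ?is_diag_mx_is_trig// unitfE.
  by apply/prodf_neq0 => i _; rewrite gt_eqF.
rewrite HE -mulmxA mulmxA UU mul1mx.
apply: (MP_pinv_left_inverse pinv).
  by rewrite mulmxA -(mulmxA Sig) VV mulmx1 mulmxV.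
have -> : V *m invmx Sig *m (Sig *m V^T) = V *m V^T.
  by rewrite mulmxA -(mulmxA V) mulVmx// mulmx1.
by rewrite trmx_mul trmxK.
Qed.

End thin_svd.

Section bias_function.
Context {R : realType} {N : nat}.
Implicit Types (sigma C : R) (k : 'I_N) (x : 'cV[R]_N).

Lemma mpowZ D (c : R) (z : 'cV[R]_D) (p : mindex D) :
  mpow (c *: z) p = c ^+ mabs p * mpow z p.
Proof.
by rewrite expr_sum -big_split; apply: eq_bigr => l _; rewrite mxE exprMn.
Qed.

Lemma bias_cE D sigma k (Hp : 'M[R]_(D, N)) (x1 : 'cV[R]_D) C (a : mindex D -> R) x :
  0 <= C -> (forall p, `|a p / sigma ^+ mabs p| <= C ^+ mabs p) ->
  bias_c sigma k Hp x1 a x =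
  hermite_series 0 (fun p => a p / sigma ^+ mabs p) (x1^~ 0) ((Hp *m x)^~ 0) - x k 0.
Proof.
move=> C_ge0 a_le; rewrite (hermite_series_e0 C_ge0 a_le); congr (expR _ * _ - _).
  by rewrite -mulmxA mxE; apply: eq_bigr => l _; rewrite mxE.
congr csum; apply/funext => p; rewrite mpowZ exprVn mulrA.
by congr (_ * _); rewrite mulrAC.
Qed.

Lemma bias_c_unit_mindex sigma k x : sigma != 0 ->
  bias_c sigma k 1%:M 0 (fun p => if p == unit_mindex k then sigma else 0) x = 0.
Proof.
move=> sigma0; rewrite /bias_c trmx0 !mul0mx mxE expR0 !mul1mx mul1r.
rewrite -[Defs.msum _]/(csum _) (csum_set1 (p := unit_mindex k)) => [|p /negbTE ->].
  rewrite eqxx /mfact big1 => [|l _]; last by rewrite ffunE; case: eqP.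
  rewrite divr1 /mpow (bigD1 k)//= ffunE eqxx expr1 big1 => [|l /negbTE lk].
    by rewrite mulr1 mxE mulVKf// subrr.
  by rewrite ffunE lk expr0.
by rewrite !mul0r.
Qed.

End bias_function.

Lemma valid_bias_hermite_series (R : realType) M N D S (H : 'M[R]_(M, N))
    (U : 'M[R]_(M, D)) (sigma : R) (k : 'I_N) (C : R) (a : mindex D -> R)
    (s : 'I_D -> R) (x0 : 'cV[R]_N) :
  U^T *m U = 1%:M -> sigma != 0 ->
  0 <= C -> (forall p, `|a p| <= C ^+ mabs p) ->
  valid_bias H sigma S k
    (fun x => hermite_series 0 a s ((U^T *m H *m x)^~ 0) - x k 0) x0.
Proof.
move=> UTU sigma0 C_ge0 a_le.
pose g (t : M.-tuple R) :=
  hermite_series (- sigma ^+ 2) a s ((projection U)^~ t).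
have mproj := measurable_projection U.
apply: (@valid_bias_exp_bounded _ _ _ _ _ _ _ sigma0 _ _ g) => [||x _].
- exact: measurable_hermite_series.
- by apply: exp_bounded_projection; exact: (exp_bounded_hermite_series C_ge0 a_le).
have momproj := exp_moments_projection U
  (gauss_prob_exp_moments (col2tup (H *m x)) sigma0).
rewrite (Rintegral_hermite_series C_ge0 a_le mproj momproj _
  (fun s => Rintegral_projection_mgf UTU _ s sigma0)) subrK.
by congr hermite_series; apply/funext => l; rewrite /projection col2tupK mulmxA.
Qed.

Theorem theorem5 (R : realType) :
  (forall (M N D S : nat) (H : 'M[R]_(M, N)) (U : 'M[R]_(M, D)) (Sig : 'M[R]_D)
     (V : 'M[R]_(N, D)) (Hp : 'M[R]_(D, N)) (sigma : R) (k : 'I_N)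
     (x1 : 'cV[R]_D) (C : R) (a : mindex D -> R),
     (1 <= S <= N)%N -> spark_gt H S -> 0 < sigma ->
     \rank H = D -> thin_svd H U Sig V ->
     is_MP_pinv (V *m invmx Sig) Hp ->
     0 <= C -> (forall p, `|a p| <= C ^+ mabs p) ->
     forall x0 : 'cV[R]_N, sparse_set S x0 ->
       valid_bias H sigma S k (bias_c sigma k Hp x1 a) x0)
  /\
  (forall (N S : nat) (Hp : 'M[R]_(N, N)) (sigma : R) (k : 'I_N),
     (1 <= S <= N)%N -> 0 < sigma ->
     is_MP_pinv ((1%:M : 'M[R]_N) *m invmx (1%:M : 'M[R]_N)) Hp ->
     forall x : 'cV[R]_N, sparse_set S x ->
       bias_c sigma k Hp 0 (fun p => if p == unit_mindex k then sigma else 0) x = 0).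
Proof.
split=> [M N D S H U Sig V Hp sigma k x1 C a _ _ sigma_gt0 _ svd pinv C_ge0 a_le x0 _
        |N S Hp sigma k _ sigma_gt0 pinv x _].
- have [UTU _ _ _ _] := svd; have HpE := thin_svd_pinv svd pinv.
  have C_sigma_ge0 : 0 <= C / sigma by rewrite divr_ge0// ltW.
  have a_sigma_le p : `|a p / sigma ^+ mabs p| <= (C / sigma) ^+ mabs p.
    rewrite normrM normfV normrX (gtr0_norm sigma_gt0) expr_div_n.
    by rewrite ler_wpM2r ?invr_ge0 ?exprn_ge0 ?(ltW sigma_gt0).
  have -> : bias_c sigma k Hp x1 a = fun x =>
      hermite_series 0 (fun p => a p / sigma ^+ mabs p) (x1^~ 0)
        ((U^T *m H *m x)^~ 0) - x k 0.
    by apply/funext => x; rewrite (bias_cE _ _ _ _ C_sigma_ge0 a_sigma_le) HpE.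
  by apply: valid_bias_hermite_series UTU _ C_sigma_ge0 a_sigma_le; rewrite gt_eqF.
- have -> : Hp = 1%:M.
    by apply: (MP_pinv_left_inverse pinv); rewrite invmx1 !mulmx1 ?trmx1.
  by apply: bias_c_unit_mindex; rewrite gt_eqF.
Qed.
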